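(* As $n\to\infty$, $H_{L_n} \sim n\ln(\alpha)$. More precisely, $H_{L_n} = n\ln(\alpha) + O(1)$.
   Context: $L_n$ ($n\ge1$) are the Lucas numbers: $L_1=1$, $L_2=3$, $L_n=L_{n-1}+L_{n-2}$ for $n\ge3$. $\alpha = \frac{1+\sqrt5}{2}$ is the golden ratio. $H_k=\sum_{i=1}^k\frac1i$ is the $k$-th harmonic number. $a_n\sim b_n$ means $a_n/b_n\to1$. *)

(* Defs.v *)
From mathcomp Require Import all_boot all_order all_algebra.
From mathcomp Require Import all_classical all_reals all_analysis.
Import Order.TTheory GRing.Theory Num.Theory.
Import numFieldNormedType.Exports.

Set Implicit Arguments.
Unset Strict Implicit.
Unset Printing Implicit Defensive.

Local Open Scope ring_scope.

(* The value 2 at index 0 is the usual backward extension of the recurrence: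
   it gives lucas 2 = 1 + 2 = 3. *)
Fixpoint lucas (n : nat) : nat :=
  match n with
  | 0 => 2
  | 1 => 1
  | (m.+1 as p).+1 => (lucas p + lucas m)%N
  end.

Definition golden_ratio (R : realType) : R := (1 + Num.sqrt 5) / 2.

Definition harmonic_number (R : realType) (k : nat) : R :=
  \sum_(1 <= i < k.+1) i%:R^-1.

Definition asymp_equiv (R : realType) (a b : nat -> R) : Prop :=
  ((fun n => a n / b n) @ \oo --> (1 : R))%classic.

(* Main.v *)
Require Import Defs.
From mathcomp Require Import all_boot all_order all_algebra.
From mathcomp Require Import all_classical all_reals all_analysis.
From mathcomp Require Import ring lra.
Import Order.TTheory GRing.Theory Num.Theory.
Import numFieldNormedType.Exports.

(** Comparing the harmonic sum with the integral of the inverse function gives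
    ln (k + 1) <= H_k <= 1 + ln k, so H_k is ln k up to a bounded error.  The
    Lucas numbers obey the same second-order recurrence as the powers of the
    golden ratio alpha, and linear recurrences with nonnegative coefficients
    preserve inequalities; hence L_n lies between alpha ^ n / 2 and
    2 * alpha ^ n for every n, and ln L_n differs from n * ln alpha by at most
    ln 2.  Together, |H_(L_n) - n * ln alpha| <= 1 + ln 2
    ([dist_harmonic_lucas]).  Since n * ln alpha tends to infinity, an error
    that is bounded is also negligible, and the asymptotic equivalence follows
    from the O(1) estimate ([asymp_equiv_bounded_diff]). *)

Local Open Scope classical_set_scope.
Local Open Scope ring_scope.

(** Concavity of the logarithm: its graph lies below its tangent at [x].
    Applied to consecutive integers, in either order, it plays the role of the
    comparison between sum and integral. *)
Lemma ln_le_tangent (R : realType) (x y : R) :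
  0 < x -> 0 < y -> ln y - ln x <= (y - x) / x.
Proof.
move=> x0 y0; rewrite -ln_div ?posrE//.
have -> : y / x = 1 + (y - x) / x by field; rewrite gt_eqF.
apply: le_ln1Dx; rewrite ltr_pdivlMr//; lra.
Qed.

Lemma ln_succ_le_harmonic (R : realType) (k : nat) :
  ln (k.+1%:R : R) <= harmonic_number R k.
Proof.
rewrite /harmonic_number; elim: k => [|k IHk]; first by rewrite big_geq// ln1.
rewrite big_nat_recr//=.
have := @ln_le_tangent R k.+1%:R k.+2%:R (ltr0Sn _ _) (ltr0Sn _ _).
have -> : (k.+2%:R - k.+1%:R : R) = 1 by rewrite -[k.+2%:R]natr1 addrAC subrr add0r.
rewrite mul1r lerBlDl => /le_trans; apply.
by rewrite lerD2r.
Qed.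

Lemma harmonic_le_ln (R : realType) (k : nat) :
  (0 < k)%N -> harmonic_number R k <= 1 + ln (k%:R : R).
Proof.
case: k => // k _; rewrite /harmonic_number.
elim: k => [|k IHk]; first by rewrite big_nat1 invr1 ln1 addr0.
rewrite big_nat_recr//=.
have := @ln_le_tangent R k.+2%:R k.+1%:R (ltr0Sn _ _) (ltr0Sn _ _).
have -> : (k.+1%:R - k.+2%:R : R) = -1
  by rewrite -[k.+2%:R]natr1 opprD addrA subrr add0r.
rewrite mulN1r; move: (k.+2%:R^-1) => v; lra.
Qed.

Lemma golden_ratio_sqr (R : realType) :
  golden_ratio R ^+ 2 = golden_ratio R + 1.
Proof.
have s5 : Num.sqrt 5 ^+ 2 = 5 :> R by rewrite sqr_sqrtr.
by rewrite /golden_ratio; field: s5.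
Qed.

Lemma golden_ratio_gt1 (R : realType) : 1 < golden_ratio R.
Proof.
have : 1 < Num.sqrt (5 : R) by rewrite -[ltLHS]sqrtr1 ltr_sqrt//; lra.
rewrite /golden_ratio; lra.
Qed.

Lemma golden_ratio_le2 (R : realType) : golden_ratio R <= 2.
Proof.
have := golden_ratio_sqr R; have := golden_ratio_gt1 R; nra.
Qed.

Lemma lucas_rec (n : nat) : lucas n.+2 = (lucas n.+1 + lucas n)%N.
Proof. by []. Qed.

(** The constant 2 is dictated by the initial values: equality holds on the
    right at [n = 0], while on the left [n = 1] asks for [golden_ratio R <= 2].
    Both bounds then propagate because both sides obey the same recurrence. *)
Lemma lucas_bounds (R : realType) (n : nat) :
  golden_ratio R ^+ n / 2 <= (lucas n)%:R <= 2 * golden_ratio R ^+ n.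
Proof.
have a1 := golden_ratio_gt1 R; have a2 := golden_ratio_le2 R.
(* A second-order recurrence: the induction carries two consecutive terms. *)
suff [] : golden_ratio R ^+ n / 2 <= (lucas n)%:R <= 2 * golden_ratio R ^+ n /\
  golden_ratio R ^+ n.+1 / 2 <= (lucas n.+1)%:R <= 2 * golden_ratio R ^+ n.+1
  by [].
elim: n => [|n [IHn IHn1]].
  rewrite expr0 expr1 /=; split; apply/andP; split; lra.
split=> //.
have -> : golden_ratio R ^+ n.+2 = golden_ratio R ^+ n.+1 + golden_ratio R ^+ n.
  by rewrite -addn2 exprD golden_ratio_sqr mulrDr mulr1 exprSr.
rewrite lucas_rec natrD.
move/andP: IHn => [? ?]; move/andP: IHn1 => [? ?]; apply/andP; split; lra.
Qed.

Lemma dist_ln_lucas (R : realType) (n : nat) :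
  `|ln ((lucas n)%:R : R) - n%:R * ln (golden_ratio R)| <= ln 2.
Proof.
have a0 : 0 < golden_ratio R by rewrite (lt_trans ltr01)// golden_ratio_gt1.
have an0 : 0 < golden_ratio R ^+ n by rewrite exprn_gt0.
have /andP[lo hi] := lucas_bounds R n.
have L0 : 0 < (lucas n)%:R :> R by apply: lt_le_trans lo; rewrite divr_gt0.
have -> : n%:R * ln (golden_ratio R) = ln (golden_ratio R ^+ n).
  by rewrite lnXn// mulr_natl.
move: lo; rewrite -ler_ln ?posrE ?divr_gt0// ln_div ?posrE// => lo.
move: hi; rewrite -ler_ln ?posrE ?mulr_gt0// lnM ?posrE// => hi.
rewrite ler_norml; apply/andP; split; lra.
Qed.

Lemma dist_harmonic_lucas (R : realType) (n : nat) :
  `|harmonic_number R (lucas n) - n%:R * ln (golden_ratio R)| <= 1 + ln 2.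
Proof.
have L0 : (0 < lucas n)%N.
  rewrite -(ltr0n R); have /andP[+ _] := lucas_bounds R n; apply: lt_le_trans.
  by rewrite divr_gt0// exprn_gt0// (lt_trans ltr01)// golden_ratio_gt1.
have up := harmonic_le_ln R _ L0.
have lo := ln_succ_le_harmonic R (lucas n).
have mono : ln ((lucas n)%:R : R) <= ln (lucas n).+1%:R.
  by rewrite ler_ln ?posrE ?ltr0n// ler_nat.
have := dist_ln_lucas R n; rewrite !ler_norml => /andP[? ?].
apply/andP; split; lra.
Qed.

(** The relative error [(a n - b n) / b n] is at most [C / b n], which tends
    to 0. *)
Lemma asymp_equiv_bounded_diff (R : realType) (a b : nat -> R) (C : R) :
  (forall n, `|a n - b n| <= C) -> b @ \oo --> +oo -> asymp_equiv a b.
Proof.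
move=> abC boo; rewrite /asymp_equiv.
have b0 : \forall n \near \oo, 0 < b n.
  by move/cvgryPgt : boo; apply.
have binv : (fun n => C * (b n)^-1) @ \oo --> (0 : R).
  rewrite -[X in _ --> X](mulr0 C); apply: cvgMr.
  exact/(gtr0_cvgV0 b0).
apply/cvgrPdist_le => e e0.
have /cvgrPdist_le /(_ _ e0) := binv.
apply: filterS2 b0 => n bn0; rewrite sub0r normrN => Cbn.
have -> : 1 - a n / b n = - ((a n - b n) / b n) by field; rewrite gt_eqF.
rewrite normrN normrM normfV (gtr0_norm bn0).
apply: le_trans (le_trans (ler_norm _) Cbn).
by rewrite ler_wpM2r// invr_ge0 ltW.
Qed.

Theorem corollary4p12 (R : realType) :
  asymp_equiv (fun n : nat => harmonic_number R (lucas n))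
              (fun n : nat => n%:R * ln (golden_ratio R))
  /\ (fun n : nat => harmonic_number R (lucas n) : R^o)
     = (fun n : nat => n%:R * ln (golden_ratio R) : R^o)
       +O_\oo (fun _ : nat => 1 : R^o).
Proof.
split.
  apply: (asymp_equiv_bounded_diff _ _ _ _ (dist_harmonic_lucas R)).
  apply: (cvg_comp (fun n : nat => n%:R) (fun x : R => x * _) cvgr_idn).
  apply: gt0_cvgMly; last exact: cvg_id.
  exact/ln_gt0/golden_ratio_gt1.
apply/eqaddOP.
have : \forall k \near +oo, 1 + ln 2 <= k :> R by apply: nbhs_pinfty_ge; rewrite num_real.
apply: filterS => k hk; apply: nearW => n /=.
rewrite normr1 mulr1; exact: le_trans (dist_harmonic_lucas R n) hk.
Qed.
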